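(* Let $p,q$ be relatively prime integers with $q\geq 1$ and $p/q\in[-1,2]$. \begin{itemize} \item If $p/q\in[0,1]$ then $\mathrm{hyp}_{p/q}$ has an SDP representation with at most $2\lfloor\log_2(q)\rfloor+1$ LMIs of size $2n\times 2n$ and one LMI of size $n\times n$. \item If $p/q\in[-1,0]\cup[1,2]$ then $\mathrm{epi}_{p/q}$ has an SDP representation with at most $2\lfloor\log_2(q)\rfloor+2$ LMIs of size $2n\times 2n$ and one LMI of size $n\times n$. \end{itemize}
   Context: $\mathbf{H}^n$ denotes the space of $n\times n$ complex Hermitian matrices, $\mathbf{H}^n_{++}$ the cone of positive definite ones; $X\succeq Y$ (equivalently $Y\preceq X$) means $X-Y$ is positive semidefinite. For $A,B\in\mathbf{H}^n_{++}$ and $t\in\mathbb{R}$, the $t$-weighted matrix geometric mean is $$A\#_tB := A^{1/2}\left(A^{-1/2}BA^{-1/2}\right)^tA^{1/2}.$$ Define, for $t\in[0,1]$, $$\mathrm{hyp}_t=\{(A,B,T)\in\mathbf{H}^n_{++}\times\mathbf{H}^n_{++}\times\mathbf{H}^n : A\#_tB\succeq T\},$$ and for $t\in[-1,0]\cup[1,2]$, $$\mathrm{epi}_t=\{(A,B,T)\in\mathbf{H}^n_{++}\times\mathbf{H}^n_{++}\times\mathbf{H}^n : A\#_tB\preceq T\}.$$ A linear matrix inequality (LMI) of size $N$ (or $N\times N$) in real variables $y_1,\dots,y_k$ is a condition $A_0+y_1A_1+\dots+y_kA_k\succeq 0$ with $A_0,\dots,A_k\in\mathbf{H}^N$ fixed.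 A convex set has a semidefinite programming (SDP) representation (SDP description) if it can be expressed using LMIs, where auxiliary (lifting) variables are allowed: a point $x$ is in the set if and only if there exist auxiliary variables $y$ such that $(x,y)$ satisfies finitely many LMIs. The size of the representation is recorded by the number of LMIs of each size. Convention: in SDP representations of $\mathrm{hyp}_t$ and $\mathrm{epi}_t$, the triple $(A,B,T)$ is implicitly understood to be restricted to $\mathbf{H}^n_{++}\times\mathbf{H}^n_{++}\times\mathbf{H}^n$; this restriction is not counted among the LMIs. *)

(* Defs.v *)
From Stdlib Require List.
From HB Require Import structures.
From mathcomp Require Import all_boot all_order all_algebra.
From mathcomp Require Import complex.
From mathcomp Require Import classical_sets reals exp.

Set Implicit Arguments.
Unset Strict Implicit.
Unset Printing Implicit Defensive.

Import Order.TTheory GRing.Theory Num.Theory.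

Local Open Scope ring_scope.
Local Open Scope complex_scope.
Local Open Scope sesquilinear_scope.
Local Open Scope classical_set_scope.

(* In the order of R[i], [0 <= z] and [0 < z] entail that z is real. *)
Definition psdmx (R : realType) (n : nat) (A : 'M[R[i]]_n) : Prop :=
  A \is hermsymmx /\ forall v : 'cV[R[i]]_n, 0 <= (v^t* *m A *m v) 0 0.

Definition pdmx (R : realType) (n : nat) (A : 'M[R[i]]_n) : Prop :=
  A \is hermsymmx /\
  forall v : 'cV[R[i]]_n, v != 0 -> 0 < (v^t* *m A *m v) 0 0.

Definition loewner_le (R : realType) (n : nat) (X Y : 'M[R[i]]_n) : Prop :=
  psdmx (Y - X).

(* Real power of a positive definite matrix by spectral calculus; junk on
   matrices that are not Hermitian positive definite. *)
Definition mxpow (R : realType) (n : nat) (A : 'M[R[i]]_n) (t : R) :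
    'M[R[i]]_n :=
  let P := spectralmx A in
  invmx P *m diag_mx (map_mx (fun z : R[i] => (complex.Re z `^ t)%:C)
                             (spectral_diag A)) *m P.

Definition gmean (R : realType) (n : nat) (t : R) (A B : 'M[R[i]]_n) :
    'M[R[i]]_n :=
  let Ah := mxpow A (1 / 2) in
  let Aih := mxpow A (- (1 / 2)) in
  Ah *m mxpow (Aih *m B *m Aih) t *m Ah.

Definition triple (R : realType) (n : nat) : Type :=
  ('M[R[i]]_n * 'M[R[i]]_n * 'M[R[i]]_n)%type.

Definition triple_dom (R : realType) (n : nat) : set (triple R n) :=
  [set x | [/\ pdmx x.1.1, pdmx x.1.2 & x.2 \is hermsymmx]].

Definition hyp (R : realType) (n : nat) (t : R) : set (triple R n) :=
  [set x | triple_dom x /\ loewner_le x.2 (gmean t x.1.1 x.1.2)].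

Definition epi (R : realType) (n : nat) (t : R) : set (triple R n) :=
  [set x | triple_dom x /\ loewner_le (gmean t x.1.1 x.1.2) x.2].

Record lmi (R : realType) (k N : nat) : Type := LMI {
  lmi_const : 'M[R[i]]_N;
  lmi_coef : 'I_k -> 'M[R[i]]_N;
  lmi_const_herm : lmi_const \is hermsymmx;
  lmi_coef_herm : forall i, lmi_coef i \is hermsymmx }.

Definition lmi_holds (R : realType) (k N : nat) (L : lmi R k N)
    (y : 'rV[R]_k) : Prop :=
  psdmx (lmi_const L + \sum_(i < k) (y 0 i)%:C *: lmi_coef L i).

(* The n^2 real coordinates of a Hermitian matrix: real parts of the entries
   on and above the diagonal; strictly below it, the imaginary parts of the
   entries.  On Hermitian matrices this is an R-linear bijection onto
   'M[R]_n. *)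
Definition hcoord (R : realType) (n : nat) (A : 'M[R[i]]_n) : 'rV[R]_(n * n) :=
  mxvec (\matrix_(i < n, j < n)
    if (i <= j)%N then complex.Re (A i j) else complex.Im (A i j)).

Definition triple_coord (R : realType) (n : nat) (x : triple R n) :
    'rV[R]_(n * n + n * n + n * n) :=
  row_mx (row_mx (hcoord x.1.1) (hcoord x.1.2)) (hcoord x.2).

(* [sizes] lists the sizes of the LMIs used; the real variables of each LMI are
   the coordinates of the triple followed by [m] lifting variables.  The
   restriction to [triple_dom] is implicit and not counted among the LMIs. *)
Definition has_sdp_rep (R : realType) (n : nat) (S : set (triple R n))
    (sizes : seq nat) : Prop :=
  exists (m : nat)
         (Ls : seq {N : nat & lmi R (n * n + n * n + n * n + m) N}),
    [seq tag L | L <- Ls] = sizes /\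
    forall x : triple R n, triple_dom x ->
      (S x <-> exists y : 'rV[R]_m,
         List.Forall (fun L => lmi_holds (tagged L) (row_mx (triple_coord x) y))
                     Ls).

(* Main.v *)
Require Import Defs.
From HB Require Import structures.
From mathcomp Require Import all_boot all_order all_algebra.
From mathcomp Require Import complex.
From mathcomp Require Import classical_sets reals sequences exp.
From mathcomp Require Import zify ring lra.

(* Write A = S S^* and B = S exp (D) S^* with S invertible and D diagonal;
   then A #_t B = S exp (t D) S^* for every t.  Name a matrix variable by its position
   r on this geodesic; every 2n x 2n LMI used is a midpoint constraint
   [e r, e m; e m, e r'] >= 0 with m = (r + r') / 2.  All of them hold on the
   geodesic itself.  Conversely, upper bounds of e r and e r' by points
   of the geodesic give one for e m, and Schur complements turn an upper bound
   for e r' and the value of e m into a lower bound for e r.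

   Dyadic positions p / 2^l are reached from 0 and 1 by l midpoints.  For
   2^l <= q < 2^(l+1), the position 2^l / q is the midpoint of 1 and
   (2^(l+1) - q) / q, and the latter lies at the dyadic fraction
   (2^(l+1) - q) / 2^l of the way from 0 to 2^l / q.  These l + 1 constraints are
   circular, but going once around them halves the exponential excess of
   e (2^l / q) over the geodesic, so that there is none; a further l midpoints
   between 0 and 2^l / q lead to p / q if p <= 2^l, and exchanging the ends
   of the geodesic covers the case p > 2^l. *)

Set Implicit Arguments.
Unset Strict Implicit.
Unset Printing Implicit Defensive.

Import Order.TTheory GRing.Theory Num.Theory.
Local Open Scope ring_scope.

(** * Hermitian forms and the Loewner order *)

Section Forms.
Local Open Scope complex_scope.
Local Open Scope ring_scope.
Local Open Scope sesquilinear_scope.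
Variable R : realType.
Implicit Types n : nat.

Lemma hermsymmxP n (A : 'M[R[i]]_n) : reflect (A^t* = A) (A \is hermsymmx).
Proof.
by apply: (iffP (is_hermitianmxP _ _ _)); rewrite expr0 scale1r.
Qed.

Lemma adjmxM m n p (A : 'M[R[i]]_(m, n)) (B : 'M[R[i]]_(n, p)) :
  (A *m B)^t* = B^t* *m A^t*.
Proof. by rewrite trmx_mul map_mxM. Qed.

Lemma adjmxD m n (A B : 'M[R[i]]_(m, n)) : (A + B)^t* = A^t* + B^t*.
Proof. by rewrite !raddfD. Qed.

Lemma adjmxB m n (A B : 'M[R[i]]_(m, n)) : (A - B)^t* = A^t* - B^t*.
Proof. by rewrite !raddfB. Qed.

Lemma hermD n (A B : 'M[R[i]]_n) :
  A \is hermsymmx -> B \is hermsymmx -> A + B \is hermsymmx.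
Proof.
by move=> /hermsymmxP hA /hermsymmxP hB; apply/hermsymmxP; rewrite adjmxD hA hB.
Qed.

Lemma hermB n (A B : 'M[R[i]]_n) :
  A \is hermsymmx -> B \is hermsymmx -> A - B \is hermsymmx.
Proof.
by move=> /hermsymmxP hA /hermsymmxP hB; apply/hermsymmxP; rewrite adjmxB hA hB.
Qed.

Lemma herm_congr n (A S : 'M[R[i]]_n) :
  A \is hermsymmx -> S *m A *m S^t* \is hermsymmx.
Proof.
by move=> /hermsymmxP hA; apply/hermsymmxP; rewrite !adjmxM trmxCK hA mulmxA.
Qed.

Definition hform n (A : 'M[R[i]]_n) (u v : 'cV[R[i]]_n) : R[i] :=
  (u^t* *m A *m v) 0 0.

Lemma hformDl n (A B : 'M[R[i]]_n) u v : hform (A + B) u v = hform A u v + hform B u v.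
Proof. by rewrite /hform mulmxDr mulmxDl mxE. Qed.

Lemma hformBl n (A B : 'M[R[i]]_n) u v : hform (A - B) u v = hform A u v - hform B u v.
Proof. by rewrite /hform mulmxBr mulmxBl !mxE. Qed.

Lemma hform_congr n (A S : 'M[R[i]]_n) u v :
  hform (S *m A *m S^t*) u v = hform A (S^t* *m u) (S^t* *m v).
Proof. by rewrite /hform adjmxM trmxCK !mulmxA. Qed.

Lemma hform_adj n (A : 'M[R[i]]_n) u v : hform (A^t*) u v = (hform A v u)^*.
Proof.
rewrite /hform.
have -> : u^t* *m A^t* *m v = (v^t* *m A *m u)^t*.
  by rewrite !adjmxM trmxCK mulmxA.
by rewrite !mxE.
Qed.

Lemma hform_diag n (d : 'rV[R[i]]_n) u v :
  hform (diag_mx d) u v = \sum_i d 0 i * ((u i 0)^* * v i 0).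
Proof.
rewrite /hform mul_mx_diag mxE; apply: eq_bigr => i _.
by rewrite !mxE [X in X * _ = _]mulrC mulrA.
Qed.

Lemma loewner_le_hform n (A B : 'M[R[i]]_n) v :
  loewner_le A B -> hform A v v <= hform B v v.
Proof. by case=> _ /(_ v); rewrite -/(hform _ _ _) hformBl subr_ge0. Qed.

Lemma loewner_leP n (A B : 'M[R[i]]_n) : A \is hermsymmx -> B \is hermsymmx ->
  (forall v, hform A v v <= hform B v v) -> loewner_le A B.
Proof.
move=> hA hB h; split; first exact: hermB.
by move=> v; rewrite -/(hform _ _ _) hformBl subr_ge0.
Qed.

Lemma loewner_le_trans n (A B C : 'M[R[i]]_n) :
  loewner_le A B -> loewner_le B C -> loewner_le A C.
Proof.
move=> [hAB pAB] [hBC pBC]; rewrite /loewner_le.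
have -> : C - A = (C - B) + (B - A) by rewrite addrA subrK.
split; first exact: hermD.
by move=> v; rewrite -/(hform _ _ _) hformDl addr_ge0 ?pAB ?pBC.
Qed.

Lemma psdmx_diag n (d : 'rV[R[i]]_n) : (forall i, 0 <= d 0 i) -> psdmx (diag_mx d).
Proof.
move=> d0; split=> [|v]; last first.
  rewrite -/(hform _ _ _) hform_diag; apply: sumr_ge0 => i _.
  by rewrite mulr_ge0// mulrC mul_conjC_ge0.
apply/hermsymmxP/matrixP => i j; rewrite !mxE eq_sym.
case: eqP => [->|_]; last by rewrite mulr0n conjC0.
by rewrite mulr1n conj_Creal// ger0_real.
Qed.

Lemma psdmx_congr n (A S : 'M[R[i]]_n) : psdmx A -> psdmx (S *m A *m S^t*).
Proof.
move=> [hA pA]; split; first exact: herm_congr.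
by move=> v; rewrite -/(hform _ _ _) hform_congr; exact: pA.
Qed.

Lemma herm_spectral n (A : 'M[R[i]]_n) : A \is hermsymmx ->
  exists (U : 'M[R[i]]_n) (d : 'I_n -> R),
   U \is unitarymx /\ A = U *m diag_mx (\row_i (d i)%:C) *m U^t*.
Proof.
move=> hA; exists ((spectralmx A)^t*), (fun i => complex.Re (spectral_diag A 0 i)).
rewrite trmxC_unitary spectral_unitarymx trmxCK; split=> //.
have -> : \row_i (complex.Re (spectral_diag A 0 i))%:C = spectral_diag A.
  apply/rowP => i; rewrite mxE RRe_real//.
  by have /mxOverP := hermitian_spectral_diag_real hA; apply.
have /orthomx_spectralP eA := hermitian_normalmx hA.
by rewrite -(invmx_unitary (spectral_unitarymx A)).
Qed.

Lemma unitary_adjl n (U : 'M[R[i]]_n) : U \is unitarymx -> U^t* *m U = 1%:M.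
Proof. by move=> hU; rewrite -invmx_unitary// mulVmx// unitarymx_unit. Qed.

Lemma unitary_adjr n (U : 'M[R[i]]_n) : U \is unitarymx -> U *m U^t* = 1%:M.
Proof. by move/unitarymxP. Qed.

(** The columns of the unitary [U] of a spectral decomposition are eigenvectors, so the hypothesis
    applies to each diagonal entry. *)
Lemma psdmx_eigen n (A : 'M[R[i]]_n) : A \is hermsymmx ->
  (forall (v : 'cV_n) (l : R), v != 0 -> A *m v = l%:C *: v -> 0 <= l) -> psdmx A.
Proof.
move=> hA h; have [U [d [hU eA]]] := herm_spectral hA.
rewrite eA; apply/psdmx_congr/psdmx_diag => i; rewrite mxE ler0c.
have UU := unitary_adjl hU.
apply: (h (U *m delta_mx i 0)).
  apply/eqP => /(congr1 (mulmx (U^t*))); rewrite mulmxA UU mul1mx mulmx0.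
  by move=> /matrixP/(_ i 0); rewrite !mxE !eqxx => /eqP; rewrite oner_eq0.
rewrite eA -!mulmxA [U^t* *m _]mulmxA UU mul1mx scalemxAr; congr (_ *m _).
apply/matrixP => j k; rewrite mul_diag_mx !mxE.
by case: (eqVneq j i) => [->|]; rewrite ?mulr0.
Qed.

End Forms.

(** * Exponential coordinates and the matrix geometric mean *)

(* Locked so that a failing match does not unfold matrix products. *)
HB.lock Definition dexp (R : realType) n (x : 'I_n -> R) : 'M[R[i]]_n :=
  diag_mx (\row_i (expR (x i))%:C%C).

HB.lock Definition congexp (R : realType) n (S : 'M[R[i]]_n) (x : 'I_n -> R) :=
  (S *m dexp x *m S^t*)%sesqui.

Section ExpDiag.
Local Open Scope complex_scope.
Local Open Scope ring_scope.
Local Open Scope sesquilinear_scope.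
Variable R : realType.
Implicit Types n : nat.

Lemma dexpE n (x : 'I_n -> R) : dexp x = diag_mx (\row_i (expR (x i))%:C).
Proof. by rewrite dexp.unlock. Qed.

Lemma congexpE n (S : 'M[R[i]]_n) x : congexp S x = S *m dexp x *m S^t*.
Proof. by rewrite congexp.unlock. Qed.

Lemma eq_dexp n (x y : 'I_n -> R) : x =1 y -> dexp x = dexp y.
Proof. by move=> xy; rewrite !dexpE; congr diag_mx; apply/rowP => i; rewrite !mxE xy. Qed.

Lemma eq_congexp n S (x y : 'I_n -> R) : x =1 y -> congexp S x = congexp S y.
Proof. by move=> xy; rewrite !congexpE (eq_dexp xy). Qed.

Lemma dexpM n (x y : 'I_n -> R) : dexp x *m dexp y = dexp (fun i => x i + y i).
Proof.
rewrite !dexpE; apply/matrixP => i j; rewrite mul_diag_mx !mxE.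
case: eqP => [->|_]; last by rewrite mulr0.
by rewrite !mulr1n expRD rmorphM.
Qed.

Lemma dexp0 n : dexp (fun=> 0 : R) = 1%:M :> 'M_n.
Proof. by rewrite dexpE; apply/matrixP => i j; rewrite !mxE expR0 rmorph1. Qed.

Lemma dexp_herm n (x : 'I_n -> R) : (dexp x)^t* = dexp x.
Proof.
rewrite dexpE; apply/hermsymmxP; apply: (psdmx_diag _).1 => i.
by rewrite mxE ler0c expR_ge0.
Qed.

Lemma congexp_herm n S (x : 'I_n -> R) : congexp S x \is hermsymmx.
Proof. by rewrite congexpE; apply: herm_congr; apply/hermsymmxP/dexp_herm. Qed.

Lemma sqnormE (z : R[i]) : (complex.Re (`|z| ^+ 2))%:C = z^* * z.
Proof. by rewrite RRe_real ?realX ?normr_real// normCK mulrC. Qed.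

Lemma hform_congexpl n S (x : 'I_n -> R) u v :
  hform (congexp S x) u v = hform (dexp x) (S^t* *m u) (S^t* *m v).
Proof. by rewrite congexpE hform_congr. Qed.

Lemma hform_congexp n S (x : 'I_n -> R) v :
  hform (congexp S x) v v = (\sum_i expR (x i) * complex.Re (`|(S^t* *m v) i 0| ^+ 2))%:C.
Proof.
rewrite hform_congexpl dexpE hform_diag rmorph_sum; apply: eq_bigr => i _.
by rewrite mxE -sqnormE -rmorphM.
Qed.

Lemma unitmx_adj n (S : 'M[R[i]]_n) : S \in unitmx -> S^t* \in unitmx.
Proof. by move=> hS; rewrite map_unitmx unitmx_tr. Qed.

Lemma congexp_pd n S (x : 'I_n -> R) : S \in unitmx -> pdmx (congexp S x).
Proof.
move=> hS; split; first exact: congexp_herm.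
move=> v v0; rewrite -/(hform _ _ _) hform_congexp ltcR.
have w0 : S^t* *m v != 0.
  apply: contra v0 => /eqP w0.
  by rewrite -(mulKmx (unitmx_adj hS) v) w0 mulmx0.
have [i wi] : exists i, (S^t* *m v) i 0 != 0.
  apply/existsP; apply: contraNT w0; rewrite negb_exists => /forallP w0.
  by apply/eqP/matrixP => i j; rewrite ord1 [RHS]mxE; apply/eqP/negbNE/w0.
have nn (z : R[i]) : 0 <= complex.Re (`|z| ^+ 2).
  by rewrite -ler0c sqnormE mulrC mul_conjC_ge0.
rewrite (bigD1 i)// ltr_pwDl//; last by apply: sumr_ge0 => j _; rewrite mulr_ge0 ?expR_ge0 ?nn.
by rewrite mulr_gt0 ?expR_gt0// -ltcR sqnormE mulrC mul_conjC_gt0.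
Qed.

Lemma pd_congexp n (A : 'M[R[i]]_n) : pdmx A ->
  exists (U : 'M[R[i]]_n) (x : 'I_n -> R), U \is unitarymx /\ A = congexp U x.
Proof.
move=> [hA pA]; have [U [d [hU eA]]] := herm_spectral hA.
have d0 i : 0 < d i.
  have := pA (U *m delta_mx i 0); rewrite -/(hform _ _ _).
  have UU := unitary_adjl hU.
  rewrite eA hform_congr mulmxA UU mul1mx hform_diag (bigD1 i)//= big1; last first.
    by move=> j /negPf ji; rewrite !mxE ji/= !mulr0.
  rewrite !mxE !eqxx/= conjC1 !mulr1 addr0 ltcR; apply.
  apply/eqP => /(congr1 (mulmx (U^t*))); rewrite mulmxA UU mul1mx mulmx0.
  by move=> /matrixP/(_ i 0); rewrite !mxE !eqxx => /eqP; rewrite oner_eq0.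
exists U, (fun i => ln (d i)); split=> //; rewrite eA congexpE dexpE.
suff -> : \row_i (expR (ln (d i)))%:C = \row_i (d i)%:C by [].
by apply/rowP => i; rewrite !mxE lnK// posrE.
Qed.

(** [mxpow] uses the eigenbasis [P] chosen by [spectralmx], which need not come from [U]. The matrix
    [V = P U] intertwines the two diagonal matrices, so [V i j != 0] forces the eigenvalues [e i]
    and [exp (x j)] to agree; hence [V] also intertwines their [t]-th powers. *)
Lemma mxpow_congexp n (U : 'M[R[i]]_n) (x : 'I_n -> R) (t : R) :
  U \is unitarymx -> mxpow (congexp U x) t = congexp U (fun i => t * x i).
Proof.
move=> hU; have /orthomx_spectralP := hermitian_normalmx (congexp_herm U x).
have AU : congexp U x *m U = U *m dexp x by rewrite congexpE -mulmxA unitary_adjl// mulmx1.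
rewrite /mxpow; have := spectral_unit (congexp U x).
move: (congexp U x) (spectralmx _) (spectral_diag _) AU => A P e AU uP eA.
have key : diag_mx e *m (P *m U) = P *m U *m dexp x.
  have PA : P *m A = diag_mx e *m P by rewrite [in LHS]eA -mulmxA (mulKVmx uP).
  by rewrite mulmxA -PA -!mulmxA AU.
suff keyt : diag_mx (map_mx (fun z => (complex.Re z `^ t)%:C) e) *m (P *m U)
    = P *m U *m dexp (fun i => t * x i).
  rewrite congexpE -[LHS]mulmx1 -(unitary_adjr hU) !mulmxA; congr (_ *m _).
  by rewrite -2!mulmxA keyt -mulmxA mulKmx.
move: (P *m U) key => V key; rewrite dexpE in key; rewrite dexpE; apply/matrixP => i j.
have /matrixP/(_ i j) := key; rewrite !mul_diag_mx !mul_mx_diag !mxE => h.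
have [->|V0] := eqVneq (V i j) 0; first by rewrite mul0r mulr0.
have -> : e 0 i = (expR (x j))%:C by apply: (mulIf V0); rewrite h mulrC.
by rewrite mulrC /= /powR gt_eqF ?expR_gt0// expRK.
Qed.

Lemma congexp0 n (S : 'M[R[i]]_n) : congexp S (fun=> 0) = S *m S^t*.
Proof. by rewrite congexpE dexp0 mulmx1. Qed.

Lemma congexp_mull n (T S : 'M[R[i]]_n) x : T *m congexp S x *m T^t* = congexp (T *m S) x.
Proof. by rewrite !congexpE adjmxM !mulmxA. Qed.

Lemma congexp_shift n (S : 'M[R[i]]_n) x y :
  congexp (S *m dexp x) y = congexp S (fun i => x i + y i + x i).
Proof. by rewrite !congexpE adjmxM dexp_herm -!dexpM !mulmxA. Qed.

Lemma pd_sqrt n (A : 'M[R[i]]_n) : pdmx A ->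
  let H := mxpow A (1 / 2) in let K := mxpow A (- (1 / 2)) in
  [/\ H *m H = A, K *m H = 1%:M, H^t* = H & K^t* = K].
Proof.
move=> /pd_congexp[U [x [hU ->]]]; rewrite !mxpow_congexp//.
have mulUU y z : congexp U y *m congexp U z = congexp U (fun i => y i + z i).
  rewrite !congexpE -dexpM -(mulmxA (U *m dexp y)) -(mulmxA U (dexp z)).
  by rewrite (mulmxA (U^t*) U) (unitary_adjl hU) mul1mx !mulmxA.
split; [| |exact/hermsymmxP/congexp_herm|exact/hermsymmxP/congexp_herm].
- by rewrite mulUU; apply: eq_congexp => i; field.
- by rewrite mulUU -(unitary_adjr hU) -congexp0; apply: eq_congexp => i; field.
Qed.

(** With [H = A^(1/2)], [K = A^(-1/2)] and the diagonalization [K B K = U exp (x) U^*], take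
    [S = H U]. *)
Lemma simdiag n (A B : 'M[R[i]]_n) : pdmx A -> pdmx B ->
  exists (S : 'M[R[i]]_n) (x : 'I_n -> R),
  [/\ S \in unitmx, A = congexp S (fun=> 0) & B = congexp S x].
Proof.
move=> pA pB; have [] := pd_sqrt pA.
move: (mxpow A (1 / 2)) (mxpow A (- (1 / 2))) => H K HH KH hH hK.
have HK : H *m K = 1%:M by apply: mulmx1C.
have pM : pdmx (K *m B *m K).
  case: pB => hB pB; split; first by rewrite -{2}hK; apply: herm_congr.
  move=> v v0; rewrite -/(hform _ _ _) -{2}hK hform_congr hK; apply: pB.
  apply: contra v0 => /eqP Kv.
  by rewrite -[v]mul1mx -HK -mulmxA Kv mulmx0.
have [U [x [hU eM]]] := pd_congexp pM; exists (H *m U), x; split.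
- have [uH _] := mulmx1_unit HK.
  by rewrite unitmx_mul uH unitarymx_unit.
- by rewrite -congexp_mull congexp0 unitary_adjr// mulmx1 hH.
- by rewrite -congexp_mull -eM hH !mulmxA HK mul1mx -mulmxA KH mulmx1.
Qed.

(** The square root [H] of [S exp (x) S^*] agrees with [S exp (x / 2)] only up to the unitary
    [V = H^-1 S exp (x / 2)]. Conjugation by [H^-1] turns the second argument into
    [V exp (y - x) V^*], whose power is known, and [H V = S exp (x / 2)] leads back to [S]. *)
Lemma gmean_congexp n (S : 'M[R[i]]_n) x y (t : R) : S \in unitmx ->
  gmean t (congexp S x) (congexp S y) = congexp S (fun i => (1 - t) * x i + t * y i).
Proof.
move=> hS; have [] := pd_sqrt (congexp_pd x hS); rewrite /gmean.
move: (mxpow (congexp S x) (1 / 2)) (mxpow (congexp S x) (- (1 / 2))) => H K HH KH hH hK.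
have HK : H *m K = 1%:M by apply: mulmx1C.
pose V := K *m S *m dexp (fun i => x i / 2).
have eS (z : 'I_n -> R) : K *m congexp S z *m K = congexp V (fun i => z i - x i).
  by rewrite -{2}hK congexp_mull congexp_shift; apply: eq_congexp => i; field.
have hV : V \is unitarymx.
  apply/unitarymxP; rewrite -congexp0; transitivity (K *m congexp S x *m K).
    by rewrite eS; apply: eq_congexp => i; rewrite subrr.
  by rewrite -HH mulmxA KH mul1mx HK.
rewrite eS mxpow_congexp// -{2}hH congexp_mull.
have -> : H *m V = S *m dexp (fun i => x i / 2).
  by rewrite /V -mulmxA mulmxA HK mul1mx.
by rewrite congexp_shift; apply: eq_congexp => i; field.
Qed.

End ExpDiag.

(** * Midpoint constraints *)

Section Blocks.
Local Open Scope complex_scope.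
Local Open Scope ring_scope.
Local Open Scope sesquilinear_scope.
Variables (R : realType) (n : nat).
Implicit Types (A F W S Z T : 'M[R[i]]_n) (x y : 'I_n -> R).

(** The quadratic form of [[A, F; F, W]] at [(u, v)], written on the blocks and intended for
    Hermitian [F]. *)
Definition block_psd A F W := forall u v,
  0 <= hform A u u + hform F u v + hform F v u + hform W v v.

Lemma block_psd_le A F W A' W' : loewner_le A A' -> loewner_le W W' ->
  block_psd A F W -> block_psd A' F W'.
Proof.
move=> hA hW h u v; apply: le_trans (h u v) _.
by apply: lerD (loewner_le_hform v hW); rewrite !lerD2r (loewner_le_hform u hA).
Qed.

Lemma hformNr A u v : hform A u (- v) = - hform A u v.
Proof. by rewrite /hform mulmxN mxE. Qed.

Lemma hformNl A u v : hform A (- u) v = - hform A u v.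
Proof. by rewrite /hform !raddfN/= !mulNmx mxE. Qed.

Lemma hformBr A u v w : hform A u (v - w) = hform A u v - hform A u w.
Proof. by rewrite /hform mulmxBr mxE [X in _ + X]mxE. Qed.

Lemma hformZr A u v (c : R[i]) : hform A u (c *: v) = c * hform A u v.
Proof. by rewrite /hform -scalemxAr mxE. Qed.

Lemma hform_mulr A F u v : hform A u (F *m v) = hform (A *m F) u v.
Proof. by rewrite /hform !mulmxA. Qed.

Lemma hform_mull A F u v : hform A (F *m u) v = hform (F^t* *m A) u v.
Proof. by rewrite /hform adjmxM !mulmxA. Qed.

Lemma hform_dexp_real x v : (hform (dexp x) v v)^* = hform (dexp x) v v.
Proof. by rewrite -hform_adj dexp_herm. Qed.

(** After pulling [u] and [v] back by [S^*], the form is a sum of squares [|a u_i + b v_i|^2] with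
    [a = exp (x_i / 2)] and [b = exp (y_i / 2)]. *)
Lemma block_psd_mid S x y :
  block_psd (congexp S x) (congexp S (fun i => (x i + y i) / 2)) (congexp S y).
Proof.
move=> u v; rewrite !hform_congexpl.
move: (S^t* *m u) (S^t* *m v) => {}u {}v; rewrite !dexpE !hform_diag -!big_split/=.
apply: sumr_ge0 => i _; rewrite !mxE.
set a := (expR (x i / 2))%:C; set b := (expR (y i / 2))%:C.
have ea : (expR (x i))%:C = a * a by rewrite /a -rmorphM -expRD -splitr.
have eb : (expR (y i))%:C = b * b by rewrite /b -rmorphM -expRD -splitr.
have ec : (expR ((x i + y i) / 2))%:C = a * b.
  by rewrite /a /b -rmorphM -expRD mulrDl.
have ra : a^* = a by apply: conjc_real.
have rb : b^* = b by apply: conjc_real.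
have := mul_conjC_ge0 (a * u i 0 + b * v i 0).
rewrite rmorphD !rmorphM /= ra rb ea eb ec; congr (_ <= _); ring.
Qed.

Lemma invmx_adj S : S \in unitmx -> S^t* *m (invmx S)^t* = 1%:M.
Proof. by move=> hS; rewrite -adjmxM mulVmx// trmx1 map_mx1. Qed.

Lemma herm_congr_factor S F : S \in unitmx -> F \is hermsymmx ->
  exists2 X, X \is hermsymmx & F = S *m X *m S^t*.
Proof.
move=> hS hF; exists (invmx S *m F *m (invmx S)^t*); first exact: herm_congr.
by rewrite -!mulmxA -adjmxM mulmxV// trmx1 map_mx1 mulmx1 mulKVmx.
Qed.

(* Otherwise [dexp m - X] has an eigenvector [v] for some [l < 0], where
   [m = (x + y) / 2] and [F = S *m X *m S^t*]; testing the block matrix at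
   [(- exp ((y - x) / 2) v, v)] gives the value [2 l v^* exp ((y - x) / 2) v]. *)
Lemma block_psd_le_mid S x y A F W : S \in unitmx -> F \is hermsymmx ->
  block_psd A F W -> loewner_le A (congexp S x) -> loewner_le W (congexp S y) ->
  loewner_le F (congexp S (fun i => (x i + y i) / 2)).
Proof.
move=> hS hF bl lA lW; have {bl lA lW}bl := block_psd_le lA lW bl.
have [X hX eF] := herm_congr_factor hS hF.
rewrite /loewner_le {1}eF congexpE -mulmxBl -mulmxBr.
set m := fun i : 'I_n => _; apply: psdmx_congr; apply: psdmx_eigen.
  by apply: (hermB _ hX); apply/hermsymmxP/dexp_herm.
move=> v l v0; rewrite mulmxBl => eXv; rewrite leNgt; apply/negP => l0.
(* Since [k + m = y] and [x + 2 k = y], each term of the test reduces to [v^* exp (y) v], the cross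
   terms up to the error [l v^* exp (k) v]. *)
pose k i := (y i - x i) / 2.
have {}eXv : X *m v = dexp m *m v - l%:C *: v by rewrite -eXv opprB addrC subrK.
have eX : hform X (dexp k *m v) v = hform (dexp y) v v - l%:C * hform (dexp k) v v.
  rewrite -[X in hform X]mul1mx -hform_mulr eXv hformBr hformZr.
  rewrite !hform_mull !hform_mulr dexp_herm !mulmx1 dexpM.
  by rewrite (@eq_dexp _ _ _ y)// => i; rewrite /k /m; field.
have eX' : hform X v (dexp k *m v) = hform X (dexp k *m v) v.
  move/hermsymmxP: hX => hX; rewrite -[in LHS]hX hform_adj eX.
  have -> (a b c : R[i]) : (a - b * c)^* = a^* - b^* * c^* by rewrite rmorphB rmorphM.
  have -> : (l%:C)^* = l%:C by apply: conjc_real.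
  by rewrite (hform_dexp_real y) (hform_dexp_real k).
have ex : hform (dexp x) (dexp k *m v) (dexp k *m v) = hform (dexp y) v v.
  rewrite hform_mull hform_mulr dexp_herm !dexpM.
  by rewrite (@eq_dexp _ _ _ y)// => i; rewrite /k; field.
have := bl ((invmx S)^t* *m - (dexp k *m v)) ((invmx S)^t* *m v).
rewrite eF !hform_congexpl !hform_congr !(mulmxA (S^t*)) !invmx_adj// !mul1mx.
rewrite !hformNr !hformNl opprK ex eX' eX.
set c := hform (dexp y) v v; have kv : 0 < hform (dexp k) v v.
  have [_ /(_ v v0)] := congexp_pd k (unitmx1 _ n).
  by rewrite congexpE mul1mx trmx1 map_mx1 mulmx1.
have -> : c - (c - l%:C * hform (dexp k) v v) - (c - l%:C * hform (dexp k) v v) + c =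
  l%:C * hform (dexp k) v v *+ 2 by ring.
rewrite pmulrn_lge0// pmulr_lge0// ler0c => l0'.
by move: l0; rewrite ltNge l0'.
Qed.

(** Schur complement: with [Z] relaxed to [exp (x)] in the coordinates of [S], the test vector
    [- exp (y - x) w] leaves the form of [T] minus that of [exp (y) exp (- x) exp (y)]. *)
Lemma block_psd_le_epi S x y T Z : S \in unitmx -> T \is hermsymmx ->
  block_psd T (congexp S y) Z -> loewner_le Z (congexp S x) ->
  loewner_le (congexp S (fun i => 2 * y i - x i)) T.
Proof.
move=> hS hT bl lZ; apply: (loewner_leP (congexp_herm _ _) hT) => u.
pose k i := y i - x i; pose w := S^t* *m u.
have := bl u ((invmx S)^t* *m - (dexp k *m w)).
set v := _ *m - _; move=> h.
have {h}: 0 <= hform T u u + hform (congexp S y) u v + hform (congexp S y) v u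
    + hform (congexp S x) v v.
  by apply: le_trans h _; rewrite lerD2l loewner_le_hform.
rewrite !hform_congexpl -/w /v !(mulmxA (S^t*)) invmx_adj// mul1mx !hformNr !hformNl opprK.
have e1 : hform (dexp y) w (dexp k *m w) = hform (dexp (fun i => 2 * y i - x i)) w w.
  rewrite hform_mulr dexpM.
  by rewrite (@eq_dexp _ _ _ (fun i => 2 * y i - x i))// => i; rewrite /k; ring.
have -> : hform (dexp y) (dexp k *m w) w = hform (dexp y) w (dexp k *m w).
  by rewrite -[in LHS](dexp_herm y) hform_adj e1 hform_dexp_real.
have -> : hform (dexp x) (dexp k *m w) (dexp k *m w) = hform (dexp y) w (dexp k *m w).
  rewrite e1 -{1 2}(dexp_herm k) -hform_congr dexp_herm !dexpM.
  by rewrite (@eq_dexp _ _ _ (fun i => 2 * y i - x i))// => i; rewrite /k; ring.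
by rewrite e1 subrK subr_ge0.
Qed.

Lemma congexp_le S x y : (forall i, x i <= y i) -> loewner_le (congexp S x) (congexp S y).
Proof.
move=> xy; apply: loewner_leP => [||v]; [exact: congexp_herm|exact: congexp_herm|].
rewrite !hform_congexp lecR; apply: ler_sum => i _; apply: ler_wpM2r.
  by rewrite -ler0c sqnormE mulrC mul_conjC_ge0.
by rewrite ler_expR.
Qed.

Lemma hform_congexp_shift S x (c : R) v :
  hform (congexp S (fun i => x i + c)) v v = (expR c)%:C * hform (congexp S x) v v.
Proof.
rewrite !hform_congexp -rmorphM mulr_sumr; congr (_%:C); apply: eq_bigr => i _.
by rewrite addrC expRD mulrA.
Qed.

(** Let [z] and [g] be the values of the two forms at a fixed [v]. If [z > g], then
    [ln (z / g) <= c / 2^k] for all [k], against the Archimedean property. *)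
Lemma loewner_le_congexp_lim S x Z (c : R) : 0 <= c -> Z \is hermsymmx ->
  (forall k, loewner_le Z (congexp S (fun i => x i + c / 2 ^+ k))) ->
  loewner_le Z (congexp S x).
Proof.
move=> c0 hZ h; apply: (loewner_leP hZ (congexp_herm _ _)) => v.
have [z ez] : exists z, hform Z v v = z%:C.
  exists (complex.Re (hform Z v v)); rewrite RRe_real// CrealE.
  by rewrite -hform_adj (hermsymmxP _ hZ).
have [g eg] : exists2 g, 0 <= g & hform (congexp S x) v v = g%:C.
  rewrite hform_congexp; eexists; last by [].
  apply: sumr_ge0 => i _; rewrite mulr_ge0 ?expR_ge0//.
  by rewrite -ler0c sqnormE mulrC mul_conjC_ge0.
move=> egv; rewrite ez egv lecR leNgt; apply/negP => gz.
have hk k : z <= expR (c / 2 ^+ k) * g.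
  by have := loewner_le_hform v (h k); rewrite hform_congexp_shift ez egv -rmorphM lecR.
(* For [g = 0] the bound at [k = 0] already gives [z <= 0]. *)
have g0 : 0 < g.
  rewrite lt_neqAle eg andbT; apply/eqP => g0.
  by have := hk 0%N; rewrite -g0 mulr0 leNgt g0 gz.
have r0 : 0 < ln (z / g) by rewrite ln_gt0// ltr_pdivlMr// mul1r.
have {}hk k : ln (z / g) <= c / 2 ^+ k.
  rewrite -[leRHS]expRK ler_ln ?posrE ?expR_gt0 ?divr_gt0//; last exact: lt_trans gz.
  by rewrite ler_pdivrMr.
pose N := Num.bound (c / ln (z / g)).
have cN : c / ln (z / g) < 2 ^+ N.
  apply: lt_trans (archi_boundP _) _; first by rewrite divr_ge0// ltW.
  by rewrite -natrX ltr_nat ltn_expl.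
have := hk N; rewrite ler_pdivlMr ?exprn_gt0// leNgt => /negP; apply.
by rewrite mulrC -ltr_pdivrMr.
Qed.

(** Supplies the initial excess for the halving argument. Writing [Z = S X S^*], a constant [M]
    above the eigenvalues of [X] bounds [X], and [c] absorbs both [ln M] and the [x i]. *)
Lemma congexp_bounded S x Z : S \in unitmx -> Z \is hermsymmx ->
  exists2 c : R, 0 <= c & loewner_le Z (congexp S (fun i => x i + c)).
Proof.
move=> hS hZ; have [X hX eZ] := herm_congr_factor hS hZ.
have [U [d [hU eX]]] := herm_spectral hX.
(* The leading [1] keeps [M] positive, so that [exp (ln M) = M]. *)
pose M := 1 + \sum_i `|d i|.
have M0 : 0 < M by rewrite ltr_pwDl// sumr_ge0.
have dM i : d i <= M.
  apply: le_trans (ler_norm _) _; rewrite /M (bigD1 i)//= addrCA.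
  by rewrite lerDl addr_ge0// sumr_ge0.
exists (`|ln M| + \sum_i `|x i|); first by rewrite addr_ge0// sumr_ge0.
apply: (@loewner_le_trans _ _ _ (congexp S (fun=> ln M))); last first.
  apply: congexp_le => i; rewrite addrCA -[leLHS]addr0 lerD ?ler_norm//.
  rewrite (bigD1 i)//= addrA addr_ge0 ?sumr_ge0//.
  by rewrite -lerBlDl sub0r -normrN ler_norm.
rewrite /loewner_le eZ congexpE -mulmxBl -mulmxBr; apply: psdmx_congr.
have -> : dexp (fun=> ln M) = U *m diag_mx (\row_i M%:C) *m U^t*.
  have -> : \row_i M%:C = const_mx M%:C :> 'rV_n by apply/rowP => i; rewrite !mxE.
  rewrite dexpE diag_const_mx mul_mx_scalar -scalemxAl unitary_adjr// scalemx1 -diag_const_mx.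
  by congr diag_mx; apply/rowP => i; rewrite !mxE lnK.
rewrite eX -mulmxBl -mulmxBr -raddfB; apply: psdmx_congr; apply: psdmx_diag => i.
by rewrite !mxE subr_ge0 lecR.
Qed.

End Blocks.

(** * Chains of midpoint constraints along the geodesic *)

Section Midpoints.
Local Open Scope complex_scope.
Local Open Scope ring_scope.
Local Open Scope sesquilinear_scope.
Variables (R : realType) (n : nat).
Implicit Types (e : R -> 'M[R[i]]_n) (cs : seq (R * R)) (S : 'M[R[i]]_n).
Implicit Types (d : 'I_n -> R) (g r : R) (l p q : nat).

(* [e r] is a matrix variable standing for the point [A #_r B] of the geodesic
   through [A] and [B]. *)
Definition midpoints cs e := forall c, c \in cs ->
  block_psd (e c.1) (e ((c.1 + c.2) / 2)) (e c.2).

Lemma midpoints_cons c cs e : midpoints (c :: cs) e <->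
  block_psd (e c.1) (e ((c.1 + c.2) / 2)) (e c.2) /\ midpoints cs e.
Proof.
split=> [h|[hc h] c']; last by rewrite in_cons => /predU1P[->|/h].
by split=> [|c' cc']; apply: h; rewrite in_cons ?eqxx// cc' orbT.
Qed.

Lemma midpoints_cat cs cs' e :
  midpoints (cs ++ cs') e <-> midpoints cs e /\ midpoints cs' e.
Proof.
split=> [h|[h h'] c]; last by rewrite mem_cat => /orP[/h|/h'].
by split=> c hc; apply: h; rewrite mem_cat hc ?orbT.
Qed.

Lemma midpoints_geodesic cs S d : midpoints cs (fun r => congexp S (fun i => r * d i)).
Proof.
move=> c _ /=; rewrite (@eq_congexp _ _ _ (fun i => (c.1 + c.2) / 2 * d i)
  (fun i => (c.1 * d i + c.2 * d i) / 2)); first exact: block_psd_mid.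
by move=> i; field.
Qed.

(** [g] is the exponential excess: [e r] is at most [exp g] times the point [S exp (r d) S^*] of the
    geodesic. *)
Definition below e S d g r := loewner_le (e r) (congexp S (fun i => r * d i + g)).

Lemma below_le e S d g g' r : g <= g' -> below e S d g r -> below e S d g' r.
Proof.
move=> gg' h; apply: loewner_le_trans h _; apply: congexp_le => i.
by rewrite lerD2l.
Qed.

(** [block_psd_le_mid] averages the exponents, hence positions and excesses alike. *)
Lemma below_mid e S d g g' r r' : S \in unitmx -> (forall r, e r \is hermsymmx) ->
  block_psd (e r) (e ((r + r') / 2)) (e r') ->
  below e S d g r -> below e S d g' r' ->
  below e S d ((g + g') / 2) ((r + r') / 2).
Proof.
move=> hS he hb h h'; have := block_psd_le_mid hS (he _) hb h h'.
rewrite /below (@eq_congexp _ _ _ _ (fun i => (r + r') / 2 * d i + (g + g') / 2)) => [|i].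
  exact.
by field.
Qed.

(** The position [p / 2^(l+1)] of the way is the midpoint of [a] and the position [p / 2^l] of the
    way; for [p > 2^l] the same is done from [b] with [2^(l+1) - p]. The list [cs] is chosen before
    [e], [S], [d] and [g], as the LMIs must not depend on the matrices. *)
Lemma dyadic_midpoints l p (a b : R) : (p <= 2 ^ l)%N ->
  exists2 cs, size cs = l & forall e S d g,
    S \in unitmx -> (forall r, e r \is hermsymmx) -> midpoints cs e ->
    below e S d g a -> below e S d g b ->
    below e S d g (a + (b - a) * (p%:R / (2 ^ l)%:R)).
Proof.
elim: l p a b => [|l IH] p a b hp.
  exists [::]; first by [].
  move=> e S d g _ _ _ ha hb; have [->|->] : p = 0%N \/ p = 1%N by lia.
    by rewrite mul0r mulr0 addr0; exact: ha.
  by rewrite expn0 divr1 mulr1 addrC subrK; exact: hb.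
have l0 : (2 ^ l)%:R != 0 :> R by rewrite pnatr_eq0 -lt0n expn_gt0.
have [pl|lp] := leqP p (2 ^ l).
  have [cs scs hcs] := IH p a b pl.
  set m := a + _ in hcs.
  exists ((a, m) :: cs); first by rewrite /= scs.
  move=> e S d g hS he /midpoints_cons[hm /hcs{}hcs] ha hb.
  have := below_mid hS he hm ha (hcs _ _ _ hS he ha hb).
  have -> : (g + g) / 2 = g by field.
  by congr below; rewrite /= /m expnS natrM; field.
have hp' : (2 ^ l.+1 - p <= 2 ^ l)%N by rewrite expnS; lia.
have [cs scs hcs] := IH _ b a hp'.
set m := b + _ in hcs.
exists ((b, m) :: cs); first by rewrite /= scs.
move=> e S d g hS he /midpoints_cons[hm /hcs{}hcs] ha hb.
have := below_mid hS he hm hb (hcs _ _ _ hS he hb ha).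
have -> : (g + g) / 2 = g by field.
by congr below; rewrite /= /m natrB// expnS natrM; field.
Qed.

(* With [tau = a + (b - a) 2^l / q], the constraint at [(b, omega)] has midpoint
   [tau], and [omega] is reached from [a] and [tau] by dyadic steps; so a bound
   on [e tau] that exceeds the geodesic by [g] improves to one exceeding it
   by [g / 2]. *)
Lemma small_midpoints l p q (a b : R) : (p <= 2 ^ l <= q)%N -> (q <= 2 ^ l.+1)%N ->
  exists2 cs, size cs = (2 * l + 1)%N & forall e S d,
    S \in unitmx -> (forall r, e r \is hermsymmx) -> midpoints cs e ->
    below e S d 0 a -> below e S d 0 b ->
    below e S d 0 (a + (b - a) * (p%:R / q%:R)).
Proof.
move=> /andP[pl lq] ql.
have l0 : (2 ^ l)%:R != 0 :> R by rewrite pnatr_eq0 -lt0n expn_gt0.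
have q0 : q%:R != 0 :> R by rewrite pnatr_eq0 -lt0n (leq_trans _ lq) ?expn_gt0.
have hs : (2 ^ l.+1 - q <= 2 ^ l)%N by rewrite expnS; lia.
pose tau := a + (b - a) * ((2 ^ l)%:R / q%:R).
have [cs1 scs1 hcs1] := dyadic_midpoints a tau hs.
(* [p / 2^l] of the way from [a] to [tau] is [p / q] of the way from [a] to [b]. *)
have [cs2 scs2 hcs2] := dyadic_midpoints a tau pl.
set omega := a + _ in hcs1.
exists ((b, omega) :: cs1 ++ cs2).
  by rewrite /= size_cat scs1 scs2 mul2n addnn addn1.
move=> e S d hS he /midpoints_cons[hm /midpoints_cat[m1 m2]] ha hb.
have etau : (b + omega) / 2 = tau.
  by rewrite /omega /tau natrB// expnS natrM; field; rewrite l0 q0.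
have step g : 0 <= g -> below e S d g tau -> below e S d (g / 2) tau.
  move=> g0 ht; have := hcs1 _ _ _ _ hS he m1 (below_le g0 ha) ht.
  by move/(below_mid hS he hm hb); rewrite etau add0r.
(* Some excess [g] at [tau] always exists; [k] rounds reduce it to [g / 2^k], and the limit is
   [0]. *)
have [g g0 hg] := congexp_bounded (fun i => tau * d i) hS (he tau).
have ht : below e S d 0 tau.
  rewrite /below (@eq_congexp _ _ _ _ (fun i => tau * d i)); last by move=> i; rewrite addr0.
  apply: (loewner_le_congexp_lim g0 (he _)) => k.
  rewrite -/(below e S d (g / 2 ^+ k) tau); elim: k => [|k IH].
    by rewrite expr0 divr1.
  have := step _ _ IH; rewrite exprSr invfM mulrA; apply.
  by rewrite divr_ge0 ?exprn_ge0.
have := hcs2 _ _ _ _ hS he m2 ha ht.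
by congr below; rewrite /tau; field; rewrite l0 q0.
Qed.

Lemma rational_midpoints p q : (p <= q)%N -> (0 < q)%N ->
  exists2 cs, size cs = (2 * trunc_log 2 q + 1)%N & forall e S d,
    S \in unitmx -> (forall r, e r \is hermsymmx) -> midpoints cs e ->
    e 0 = congexp S (fun=> 0) -> e 1 = congexp S d ->
    loewner_le (e (p%:R / q%:R)) (congexp S (fun i => p%:R / q%:R * d i)).
Proof.
move=> pq q0; set l := trunc_log 2 q.
have /andP[lq ql] := trunc_log_bounds (isT : 1 < 2)%N q0.
have q0' : q%:R != 0 :> R by rewrite pnatr_eq0 -lt0n.
have bl e S d x r : e r = congexp S x -> (forall i, x i = r * d i) -> below e S d 0 r.
  by move=> er hx; rewrite /below er; apply: congexp_le => i; rewrite hx addr0.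
have fin e S d r : below e S d 0 r -> loewner_le (e r) (congexp S (fun i => r * d i)).
  by rewrite /below (@eq_congexp _ _ _ _ (fun i => r * d i)) => [|i]; [exact|rewrite addr0].
have [pl|lp] := leqP p (2 ^ l).
  have [|cs scs hcs] := @small_midpoints l p q 0 1 _ (ltnW ql); first by rewrite pl.
  exists cs; first exact: scs.
  move=> e S d hS he hm h0 h1; apply: fin.
  have := hcs _ _ d hS he hm (bl _ _ _ _ _ h0 _) (bl _ _ _ _ _ h1 _).
  by rewrite subr0 mul1r add0r; apply=> i; rewrite ?mul0r ?mul1r.
(* With the ends exchanged, [p > 2^l] and [q < 2^(l+1)] give [q - p < 2^l]. *)
have [|cs scs hcs] := @small_midpoints l (q - p) q 1 0 _ (ltnW ql).
  by rewrite lq andbT; move: ql; rewrite -/l expnS; lia.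
exists cs; first exact: scs.
move=> e S d hS he hm h0 h1; apply: fin.
have := hcs _ _ d hS he hm (bl _ _ _ _ _ h1 _) (bl _ _ _ _ _ h0 _).
have -> : 1 + (0 - 1) * ((q - p)%:R / q%:R) = p%:R / q%:R :> R.
  by rewrite natrB//; field.
by apply=> i; rewrite ?mul0r ?mul1r.
Qed.

(** The geodesic itself is a witness [e]; conversely, the constraints keep any [e] through [A] and
    [B] below the geodesic at [p / q]. *)
Lemma hyp_midpoints p q : (p <= q)%N -> (0 < q)%N ->
  exists2 cs, size cs = (2 * trunc_log 2 q + 1)%N &
  forall A B T, triple_dom (A, B, T) ->
    (hyp (p%:R / q%:R) (A, B, T) <-> exists e,
      [/\ forall r, e r \is hermsymmx, e 0 = A, e 1 = B, midpoints cs e &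
       loewner_le T (e (p%:R / q%:R))]).
Proof.
move=> pq q0; have [cs scs hcs] := rational_midpoints pq q0.
exists cs; first exact: scs.
move=> A B T dom; have [/= pA pB hT] := dom.
have [S [d [hS eA eB]]] := simdiag pA pB.
have eg : gmean (p%:R / q%:R) A B = congexp S (fun i => p%:R / q%:R * d i).
  by rewrite eA eB gmean_congexp//; apply: eq_congexp => i; rewrite mulr0 add0r.
split=> [[_]|[e [he e0 e1 hm hTe]]]; last first.
  split; first exact: dom.
  apply: loewner_le_trans hTe _; rewrite eg.
  by apply: hcs hS he hm _ _; rewrite ?e0 ?e1.
rewrite [X in loewner_le _ X]eg => hTe; exists (fun r => congexp S (fun i => r * d i)); split.
- by move=> r; apply: congexp_herm.
- by rewrite eA; apply: eq_congexp => i; rewrite mul0r.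
- by rewrite eB; apply: eq_congexp => i; rewrite mul1r.
- exact: midpoints_geodesic.
- exact: hTe.
Qed.

(* [A #_t B] is the reflection of [A #_(2 c - t) B] through [A #_c B], where
   [c] is [0] or [1] and [0 <= 2 c - t <= 1]. *)
Lemma epi_midpoints (c : bool) (t : R) p q : (p <= q)%N -> (0 < q)%N ->
  2 * c%:R - t = p%:R / q%:R ->
  exists2 cs, size cs = (2 * trunc_log 2 q + 2)%N &
  forall A B T, triple_dom (A, B, T) ->
    (epi t (A, B, T) <-> exists e,
      [/\ forall r, e r \is hermsymmx, e 0 = A, e 1 = B, midpoints cs e &
       loewner_le (e t) T]).
Proof.
move=> pq q0 ct; have [cs scs hcs] := rational_midpoints pq q0.
(* The extra constraint joins [t] to its reflection [2 c - t = p / q]; its midpoint is [c], where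
   [e] is fixed as [A] or [B]. *)
exists ((t, p%:R / q%:R) :: cs); first by rewrite /= scs addn1 addn2.
move=> A B T dom; have [/= pA pB hT] := dom.
have [S [d [hS eA eB]]] := simdiag pA pB.
have eg : gmean t A B = congexp S (fun i => t * d i).
  by rewrite eA eB gmean_congexp//; apply: eq_congexp => i; rewrite mulr0 add0r.
split=> [[_]|[e [he e0 e1 /midpoints_cons[/= hb hm] hTe]]]; last first.
  split; first exact: dom.
  apply: loewner_le_trans hTe; rewrite [X in loewner_le X _]eg.
  have ec : e ((t + p%:R / q%:R) / 2) = congexp S (fun i => c%:R * d i).
    have -> : (t + p%:R / q%:R) / 2 = c%:R by rewrite -ct; field.
    case: (c); rewrite ?e1 ?e0 ?eA ?eB; apply: eq_congexp => i; rewrite ?mul1r ?mul0r//.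
  rewrite ec in hb; rewrite (@eq_congexp _ _ _ _ (fun i => 2 * (c%:R * d i) - p%:R / q%:R * d i)).
    by apply: (block_psd_le_epi hS (he t) hb); apply: hcs hS he hm _ _; rewrite ?e0 ?e1.
  by move=> i; rewrite -ct; ring.
rewrite [X in loewner_le X _]eg => hTe; exists (fun r => congexp S (fun i => r * d i)); split.
- by move=> r; apply: congexp_herm.
- by rewrite eA; apply: eq_congexp => i; rewrite mul0r.
- by rewrite eB; apply: eq_congexp => i; rewrite mul1r.
- exact: midpoints_geodesic.
- exact: hTe.
Qed.

End Midpoints.

(** * From midpoint constraints to LMIs *)

Section LMI.
Local Open Scope complex_scope.
Local Open Scope ring_scope.
Local Open Scope sesquilinear_scope.
Variable R : realType.

Definition lmi_rep k N (P : 'rV[R]_k -> Prop) :=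
  exists L : lmi R k N, forall y, lmi_holds L y <-> P y.

(** The LMI has constant term [0] and as coefficients the values of [f] at the unit vectors. *)
Lemma lmi_rep_linear k N (f : 'rV[R]_k -> 'M[R[i]]_N) :
  (forall x y, f (x + y) = f x + f y) ->
  (forall a x, f (a *: x) = a%:C *: f x) ->
  (forall x, f x \is hermsymmx) -> lmi_rep N (fun y => psdmx (f y)).
Proof.
move=> fD fZ fh; have f0 : f 0 = 0 by rewrite -(scale0r 0) fZ scale0r.
have h0 : (0 : 'M[R[i]]_N) \is hermsymmx by rewrite -f0.
exists (LMI h0 (fun i => fh (delta_mx 0 i))) => y; rewrite /lmi_holds /= add0r.
rewrite [in X in _ <-> X](row_sum_delta y) (big_morph f fD f0).
by under eq_bigr do rewrite -fZ.
Qed.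

Lemma lmi_rep_seq k N N0 (I : eqType) (P : I -> 'rV[R]_k -> Prop) (P0 : 'rV[R]_k -> Prop)
    (cs : seq I) : (forall c, lmi_rep N (P c)) -> lmi_rep N0 P0 ->
  exists2 Ls : seq {N : nat & lmi R k N},
    [seq tag L | L <- Ls] = rcons (nseq (size cs) N) N0 &
    forall y, List.Forall (fun L => lmi_holds (tagged L) y) Ls <->
      (forall c, c \in cs -> P c y) /\ P0 y.
Proof.
move=> hP [L0 hL0]; elim: cs => [|c cs [Ls tLs hLs]].
  exists [:: existT _ N0 L0]; first by [].
  move=> y; split=> [h|[_ h]].
    split; first by [].
    by apply/hL0; inversion h.
  by constructor; [apply/hL0|constructor].
have [L hL] := hP c; exists (existT _ N L :: Ls); first by rewrite /= tLs.
move=> y; split=> [h|[h h0]].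
  have [hc /hLs[hcs h0]] : lmi_holds L y /\ List.Forall (fun L => lmi_holds (tagged L) y) Ls.
    by inversion h.
  split; last exact: h0.
  move=> c'; rewrite in_cons => /predU1P[->|/hcs hc']; last exact: hc'.
  exact/hL.
constructor; first by apply/hL/h; rewrite in_cons eqxx.
by apply/hLs; split=> [c' hc'|]; [apply: h; rewrite in_cons hc' orbT|].
Qed.

End LMI.

(** * Midpoint constraints as block LMIs *)

Section Block.
Local Open Scope complex_scope.
Local Open Scope ring_scope.
Local Open Scope sesquilinear_scope.
Variables (R : realType) (n : nat).
Implicit Types A F W : 'M[R[i]]_n.

Lemma herm_block A F W : A \is hermsymmx -> F \is hermsymmx -> W \is hermsymmx ->
  block_mx A F F W \is hermsymmx.
Proof.
move=> /hermsymmxP hA /hermsymmxP hF /hermsymmxP hW; apply/hermsymmxP.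
by rewrite tr_block_mx map_block_mx hA hF hW.
Qed.

Lemma hform_block A F W u v : hform (block_mx A F F W) (col_mx u v) (col_mx u v) =
  hform A u u + hform F u v + hform F v u + hform W v v.
Proof.
rewrite /hform tr_col_mx map_row_mx mul_row_block mul_row_col !mulmxDl.
by rewrite !mxE -!addrA; congr (_ + _); rewrite addrCA.
Qed.

Lemma psdmx_block A F W : A \is hermsymmx -> F \is hermsymmx -> W \is hermsymmx ->
  psdmx (block_mx A F F W) <-> block_psd A F W.
Proof.
move=> hA hF hW; split=> [[_ h] u v|h].
  by have := h (col_mx u v); rewrite -/(hform _ _ _) hform_block.
split; first exact: herm_block.
by move=> v; rewrite -/(hform _ _ _) -[v]vsubmxK hform_block; apply: h.
Qed.

Lemma lmi_rep_block k (f g h : 'rV[R]_k -> 'M[R[i]]_n) :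
  (forall x y, f (x + y) = f x + f y) -> (forall a x, f (a *: x) = a%:C *: f x) ->
  (forall x y, g (x + y) = g x + g y) -> (forall a x, g (a *: x) = a%:C *: g x) ->
  (forall x y, h (x + y) = h x + h y) -> (forall a x, h (a *: x) = a%:C *: h x) ->
  (forall x, f x \is hermsymmx) -> (forall x, g x \is hermsymmx) ->
  (forall x, h x \is hermsymmx) ->
  lmi_rep (2 * n) (fun y => block_psd (f y) (g y) (h y)).
Proof.
move=> fD fZ gD gZ hD hZ fh gh hh.
have [||x|L hL] := @lmi_rep_linear _ _ _ (fun y => block_mx (f y) (g y) (g y) (h y)).
- by move=> x y; rewrite add_block_mx fD gD hD.
- by move=> a x; rewrite scale_block_mx fZ gZ hZ.
- exact: herm_block.
(* [block_mx] has size [n + n], so [2 * n] is rewritten before [L] can be supplied. *)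
rewrite mul2n -addnn; exists L => y.
by apply: (iff_trans (hL y)); apply: psdmx_block.
Qed.

End Block.

(** * Real coordinates and lifting variables *)

Section Coordinates.
Local Open Scope complex_scope.
Local Open Scope ring_scope.
Local Open Scope sesquilinear_scope.
Variables (R : realType) (n : nat).
Implicit Types y : 'rV[R]_(n * n).

(** Inverse of [hcoord] on Hermitian matrices; the stored imaginary parts are those below the
    diagonal, hence the minus sign above it. Its values are always Hermitian, so this requirement on
    lifting variables costs no LMI. *)
Definition hermof y : 'M[R[i]]_n := \matrix_(i, j)
  let X := vec_mx y in
  if (i < j)%N then X i j -i* X j i
  else if (j < i)%N then X j i +i* X i j else (X i i)%:C.

Lemma hermofD y y' : hermof (y + y') = hermof y + hermof y'.
Proof.
apply/matrixP => i j; rewrite !mxE.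
case: ltngtP => _; apply/eqP; rewrite eq_complex /=.
all: by rewrite !mxE ?opprD ?addr0 !eqxx.
Qed.

Lemma hermofZ (a : R) y : hermof (a *: y) = a%:C *: hermof y.
Proof.
apply/matrixP => i j; rewrite [LHS]mxE.
rewrite [RHS]mxE.
rewrite [X in _ * X]mxE.

case: ltngtP => _ /=.
all: apply/eqP; rewrite eq_complex /=.
all: by rewrite !mxE ?mul0r ?mulr0 ?subr0 ?addr0 ?mulrN !eqxx.
Qed.

Lemma hermof_herm y : hermof y \is hermsymmx.
Proof.
apply/hermsymmxP/matrixP => i j; rewrite !mxE.
have [ij|ji|ij] := ltngtP i j.
- by apply/eqP; rewrite eq_complex /= !eqxx.
- by apply/eqP; rewrite eq_complex /= opprK !eqxx.
- by rewrite (val_inj ij); apply: conjc_real.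
Qed.

Lemma hermof_hcoord (A : 'M[R[i]]_n) : A \is hermsymmx -> hermof (hcoord A) = A.
Proof.
move=> /hermsymmxP hA; have eA i j : A j i = (A i j)^* by rewrite -{1}hA !mxE.
apply/matrixP => i j; rewrite mxE /hcoord mxvecK /=.
have [ij|ji|ij] := ltngtP i j.
- rewrite !mxE (ltnW ij) leqNgt ij /= (eA i j).
  by case: (A i j) => a b /=; rewrite opprK.
- rewrite !mxE (ltnW ji) leqNgt ji /= (eA i j).
  by case: (A i j).
- have <- : i = j by apply: val_inj.
  rewrite !mxE leqnn; have /eqP := eA i i; case: (A i i) => a b.
  rewrite eq_complex /= eqxx /= => /eqP hb.
  by apply/eqP; rewrite eq_complex /= eqxx /=; apply/eqP; lra.
Qed.

(* [ps] lists the positions on the geodesic that have a matrix variable; those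
   other than [0] and [1] are lifting variables. *)
Definition coord_at (ps : seq R) (r : R)
    (z : 'rV[R]_(n * n + n * n + n * n + size ps * (n * n))) : 'rV[R]_(n * n) :=
  if r == 0 then lsubmx (lsubmx (lsubmx z))
  else if r == 1 then rsubmx (lsubmx (lsubmx z))
  else if insub (index r ps) is Some j then row j (vec_mx (rsubmx z)) else 0.

Lemma coord_atD ps r z z' :
  coord_at (ps := ps) r (z + z') = coord_at r z + coord_at r z'.
Proof.
rewrite /coord_at; case: ifP => _; first by rewrite !linearD.
case: ifP => _; first by rewrite !linearD.
by case: insubP => [j _ _|_]; rewrite ?addr0// !linearD.
Qed.

Lemma coord_atZ ps r a z : coord_at (ps := ps) r (a *: z) = a *: coord_at r z.
Proof.
rewrite /coord_at; case: ifP => _; first by rewrite !linearZ.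
case: ifP => _; first by rewrite !linearZ.
by case: insubP => [j _ _|_]; rewrite ?scaler0// !linearZ.
Qed.

(** The constraints read [e] at finitely many positions only, so the existence of [e] amounts to
    that of lifting variables. *)
Lemma sdp_rep_midpoints (b : bool) (t : R) (cs : seq (R * R)) (S : set (triple R n)) :
  (forall A B T, triple_dom (A, B, T) ->
    (S (A, B, T) <-> exists e : R -> 'M[R[i]]_n,
      [/\ forall r, e r \is hermsymmx, e 0 = A, e 1 = B, midpoints cs e &
       if b then loewner_le T (e t) else loewner_le (e t) T])) ->
  has_sdp_rep S (rcons (nseq (size cs) (2 * n)%N) n).
Proof.
move=> hS; pose mid (c : R * R) := (c.1 + c.2) / 2.
(* Positions may recur in [ps]; [index] returns the first occurrence, so all of them share one
   matrix variable. *)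
pose ps := t :: flatten [seq [:: c.1; mid c; c.2] | c <- cs].
pose f r z : 'M[R[i]]_n := hermof (coord_at (ps := ps) r z).
have fD r z z' : f r (z + z') = f r z + f r z' by rewrite /f coord_atD hermofD.
have fZ r a z : f r (a *: z) = a%:C *: f r z by rewrite /f coord_atZ hermofZ.
have fh r z : f r z \is hermsymmx by apply: hermof_herm.
pose g (z : 'rV[R]_(n * n + n * n + n * n + size ps * (n * n))) : 'M[R[i]]_n :=
  hermof (rsubmx (lsubmx z)).
have gD z z' : g (z + z') = g z + g z' by rewrite /g !linearD hermofD.
have gZ a z : g (a *: z) = a%:C *: g z by rewrite /g !linearZ hermofZ.
have gh z : g z \is hermsymmx by apply: hermof_herm.
pose w z := if b then f t z - g z else g z - f t z.
have wrep : lmi_rep n (fun z => psdmx (w z)).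
  apply: lmi_rep_linear => [z z'|a z|z].
  - by rewrite /w; case: (b); rewrite fD gD opprD addrACA.
  - by rewrite /w; case: (b); rewrite fZ gZ scalerBr.
  - by rewrite /w; case: (b); apply: hermB.
have crep (c : R * R) : lmi_rep (2 * n) (fun z => block_psd (f c.1 z) (f (mid c) z) (f c.2 z)).
  exact: (lmi_rep_block (fD _) (fZ _) (fD _) (fZ _) (fD _) (fZ _) (fh _) (fh _) (fh _)).
have [Ls tLs hLs] := lmi_rep_seq cs crep wrep.
exists (size ps * (n * n))%N, Ls; split; first exact: tLs.
move=> [[A B] T] dom; have [/= [hA _] [hB _] hT] := dom.
apply: (iff_trans (hS A B T dom)).
have fA v : f 0 (row_mx (triple_coord (A, B, T)) v) = A.
  by rewrite /f /coord_at eqxx !row_mxKl hermof_hcoord.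
have fB v : f 1 (row_mx (triple_coord (A, B, T)) v) = B.
  by rewrite /f /coord_at oner_eq0 eqxx !row_mxKl row_mxKr hermof_hcoord.
have gT v : g (row_mx (triple_coord (A, B, T)) v) = T.
  by rewrite /g !row_mxKl row_mxKr hermof_hcoord.
split=> [[e [he e0 e1 hm ht]]|[y /hLs[hm]]]; last first.
  (* Away from [0], [1] and [ps] this [e] takes the default value [0]; no constraint reads it
     there. *)
  rewrite /w gT => ht; exists (fun r => f r (row_mx (triple_coord (A, B, T)) y)).
  by split=> //; case: (b) ht.
pose y := mxvec (\matrix_(j < size ps) hcoord (e (nth 0 ps j))).
have fe r : r \in ps -> f r (row_mx (triple_coord (A, B, T)) y) = e r.
  have [->|r0 rps] := eqVneq r 0; first by rewrite fA e0.
  have [->|r1] := eqVneq r 1; first by rewrite fB e1.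
  rewrite /f /coord_at (negPf r0) (negPf r1); case: insubP => [j _ ej|]; last first.
    by rewrite index_mem rps.
  by rewrite row_mxKr mxvecK rowK ej nth_index// hermof_hcoord.
exists y; apply/hLs; split=> [c hc|].
  have cps r : r \in [:: c.1; mid c; c.2] -> r \in ps.
    move=> hr; rewrite in_cons; apply/orP; right; apply/flattenP.
    by exists [:: c.1; mid c; c.2] => //; apply/mapP; exists c.
  by rewrite !fe ?cps ?in_cons ?eqxx ?orbT//; apply: hm.
by rewrite /w gT fe ?in_cons ?eqxx//; case: (b) ht.
Qed.

End Coordinates.

(** * Representations for rational exponents *)

Lemma epi_sdp_rep (R : realType) n (c : bool) (t : R) (p : int) (q : nat) :
  0 <= p <= q%:Z -> (0 < q)%N -> 2 * c%:R - t = p%:~R / q%:R ->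
  has_sdp_rep (@epi R n t) (rcons (nseq (2 * trunc_log 2 q + 2) (2 * n)%N) n).
Proof.
case: p => // p pq q0 ct.
have [cs <- hcs] := epi_midpoints n (pq : (p <= q)%N) q0 ct.
exact: (sdp_rep_midpoints (b := false) hcs).
Qed.

Theorem theorem3 (R : realType) (n : nat) (p q : int)
    (pq_coprime : coprimez p q) (q_ge1 : 1 <= q)
    (pq_range : -1 <= (p%:~R / q%:~R : R) <= 2) :
  (0 <= (p%:~R / q%:~R : R) <= 1 ->
     exists2 k : nat, (k <= 2 * trunc_log 2 `|q| + 1)%N &
       has_sdp_rep (@hyp R n (p%:~R / q%:~R)) (rcons (nseq k (2 * n)%N) n)) /\
  ((-1 <= (p%:~R / q%:~R : R) <= 0) || (1 <= (p%:~R / q%:~R : R) <= 2) ->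
     exists2 k : nat, (k <= 2 * trunc_log 2 `|q| + 2)%N &
       has_sdp_rep (@epi R n (p%:~R / q%:~R)) (rcons (nseq k (2 * n)%N) n)).
Proof.
case: q q_ge1 {pq_coprime pq_range} => // q q0; rewrite absz_nat -!pmulrn.
have q0R : 0 < q%:R :> R by rewrite ltr0n; lia.
have q_neq0 : q%:R != 0 :> R by rewrite gt_eqF.
split=> [|/orP[|]]; rewrite ?ler_pdivlMr ?ler_pdivrMr//.
- rewrite mul0r mul1r ler0z pmulrn ler_int; case: p => // p /= pq.
  exists (2 * trunc_log 2 q + 1)%N; first by [].
  have [cs <- hcs] := hyp_midpoints R n (pq : (p <= q)%N) q0.
  exact: (sdp_rep_midpoints (b := true) hcs).
- rewrite mul0r mulN1r pmulrn -rmorphN ler_int lerz0 => pq.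
  exists (2 * trunc_log 2 q + 2)%N; first by [].
  (* Reflection in [0] sends [p / q] to [- p / q], which lies in [[0, 1]]. *)
  apply: (@epi_sdp_rep R n false _ (- p)) => //; first by lia.
  by rewrite rmorphN /= mulr0 sub0r mulNr.
- have -> : 2 * q%:R = (2 * q%:Z)%:~R :> R by rewrite rmorphM.
  rewrite mul1r pmulrn !ler_int => pq.
  exists (2 * trunc_log 2 q + 2)%N; first by [].
  (* Reflection in [1] sends [p / q] to [(2 q - p) / q], which lies in [[0, 1]]. *)
  apply: (@epi_sdp_rep R n true _ (2 * q%:Z - p)) => //; first by lia.
  by rewrite rmorphB rmorphM /= -pmulrn; field.
Qed.
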